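(* Let $\mathcal{H}$ be a Hilbert space, let $n\ge1$, let $\delta\ge0$, and suppose $\mathsf{P}_1,\dots,\mathsf{P}_n$ are orthogonal projections with respect to the inner product of $\mathcal{H}$ satisfying $$\left\|\mathsf{P}_n\cdots\mathsf{P}_1\right\|_{\mathsf{op}}\le 1-\delta.$$ Let $\mathsf{P}_{i_L}\cdots\mathsf{P}_{i_1}$ (with $i_1,\dots,i_L\in\{1,\dots,n\}$) be any product of these projections satisfying the following condition: for each $j\in\{1,\dots,n\}$ there exists a minimal index $k_j\le L$ with $i_{k_j}=j$, and these indices satisfy $$1=k_1\le k_2\le\cdots\le k_n=L.$$ Then $$\|\mathsf{P}_{i_L}\cdots\mathsf{P}_{i_1}\|_{\mathsf{op}}\le 1-\frac{\delta^2}{8(L-n+1)}.$$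
   Context: For a bounded linear operator $\mathsf{A}:\mathcal{H}\to\mathcal{H}$, $\|\mathsf{A}\|_{\mathsf{op}}=\sup_{f\in\mathcal{H},\,f\neq0}\|\mathsf{A}f\|/\|f\|$, where $\|\cdot\|$ is the norm induced by the inner product. The index $k_j$ is the position of the first occurrence of $j$ in the sequence $i_1,i_2,\dots,i_L$. *)

(* Defs.v *)
From HB Require Import structures.
From mathcomp Require Import all_boot all_order all_algebra.
From mathcomp Require Import complex.
From mathcomp Require Import all_classical all_reals all_analysis.

Set Implicit Arguments.
Unset Strict Implicit.
Unset Printing Implicit Defensive.

Import Order.TTheory GRing.Theory Num.Theory.
Import numFieldNormedType.Exports.

Local Open Scope classical_set_scope.
Local Open Scope ring_scope.

(* Hilbert spaces are real or complex: R is the field of real numbers and the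
   scalars are either R itself or R[i]. *)
Variant scalar_kind := RealScalars | ComplexScalars.

Definition scalars (R : realType) (F : scalar_kind) : numFieldType :=
  match F with
  | RealScalars => R
  | ComplexScalars => R[i]
  end.

Definition scalar_conj (R : realType) (F : scalar_kind) :
    scalars R F -> scalars R F :=
  match F with
  | RealScalars => fun x : R => x
  | ComplexScalars => fun z : R[i] => (z^*)%C
  end.

Definition scalar_re (R : realType) (F : scalar_kind) : scalars R F -> R :=
  match F with
  | RealScalars => fun x : R => x
  | ComplexScalars => fun z : R[i] => complex.Re z
  end.

Section Hilbert.
Variables (R : realType) (F : scalar_kind).
Variable H : completeNormedModType (scalars R F).

(* ip is a positive definite, conjugate-symmetric form, linear in its first
   argument; a complete normed module whose norm satisfies this is a Hilbert
   space with inner product ip. *)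
Definition norm_induced_by (ip : {dot H for @scalar_conj R F}) :=
  forall f : H, `|f| ^+ 2 = ip f f.

(* Norms are elements of the scalar field (with zero imaginary part), hence
   scalar_re.  The supremum is that of the reals, so it is 0 when H is the zero
   space, and it is the usual one as soon as A is bounded. *)
Definition opnorm (A : H -> H) : R :=
  sup [set scalar_re (`|A f| / `|f|) | f in [set f : H | f != 0]].

(* Bounded, idempotent and self-adjoint. *)
Definition orthogonal_projection (ip : {dot H for @scalar_conj R F})
    (P : {linear H -> H}) : Prop :=
  [/\ continuous P, (forall f, P (P f) = P f)
    & (forall f g, ip (P f) g = ip f (P g))].

(* For s = [:: i_1; ...; i_L] this is P i_L \o ... \o P i_1. *)
Definition opprod (n : nat) (P : 'I_n -> {linear H -> H}) (s : seq 'I_n) :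
    H -> H :=
  foldl (fun (A : H -> H) j => P j \o A) idfun s.

End Hilbert.

(* 1-based position of the first occurrence of j in s, when j \in s. *)
Definition first_pos (n : nat) (s : seq 'I_n) (j : 'I_n) : nat :=
  (index j s).+1.

(* Main.v *)
Require Import Defs.
From HB Require Import structures.
From mathcomp Require Import all_boot all_order all_algebra.
From mathcomp Require Import complex.
From mathcomp Require Import all_classical all_reals all_analysis.
From mathcomp Require Import lra.

Set Implicit Arguments.
Unset Strict Implicit.
Unset Printing Implicit Defensive.

Import Order.TTheory GRing.Theory Num.Theory.
Import numFieldNormedType.Exports.

Local Open Scope ring_scope.

(** Follow a vector f through the long product, f_t = P_{i_t} f_{t-1}.  By
    Pythagoras each projection satisfies
    |f_{t-1} - f_t|^2 = |f_{t-1}|^2 - |f_t|^2, so the squared displacements add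
    up to |f|^2 - |f_L|^2, which is small when the product barely shrinks f.

    Since the first occurrences k_1 < ... < k_n are in order, the word 1, ..., n
    is a subsequence of i_1, ..., i_L (enum_ord_subseq), and the short product
    P_n ... P_1 arises from the long one by leaving out L - n factors.  Run both
    products side by side: applying the same projection to both vectors does not
    increase their distance, and a step made by the long product only increases
    it by at most the displacement of that step.  So the two results differ by at
    most the sum of L - n displacements, and by Cauchy-Schwarz
    |f_L - P_n ... P_1 f| <= sqrt ((L - n) (|f|^2 - |f_L|^2))
    (opprod_subseq_close).

    As |P_n ... P_1 f| <= (1 - delta) |f|, this yields
    |f_L| <= (1 - delta) |f| + sqrt ((L - n) (|f|^2 - |f_L|^2)), an inequality
    between real numbers that forces |f_L| <= (1 - delta^2 / (8 (L - n + 1))) |f|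
    (defect_bound). *)

(** * Increasing first occurrences form a subsequence *)

Lemma subseq_index_sorted (T : eqType) (s t : seq T) :
  {subset t <= s} -> sorted (fun x y => (index x s < index y s)%N) t ->
  subseq t s.
Proof.
case: t => [|x0 t'] ts tsorted; first exact: sub0seq.
set t := x0 :: t' in ts tsorted *.
(* The positions of the entries of t increase, so they form a subsequence of
   all positions of s; reading s there gives back t. *)
pose ks := map (index^~ s) t.
have ks_sub : subseq ks (iota 0 (size s)).
  rewrite (_ : ks = [seq k <- iota 0 (size s) | k \in ks]) ?filter_subseq//.
  apply: (irr_sorted_eq ltn_trans ltnn).
  - by rewrite sorted_map.
  - by apply: sorted_filter; [exact: ltn_trans|exact: iota_ltn_sorted].
  - move=> k; rewrite mem_filter mem_iota add0n /=; apply/esym.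
    by apply: andb_idr => /mapP[x /ts xs ->]; rewrite index_mem.
have -> : t = map (nth x0 s) ks.
  rewrite -map_comp map_id_in// => x /ts xs.
  by rewrite /= nth_index.
by rewrite -[X in subseq _ X](mkseq_nth x0 s); apply: map_subseq.
Qed.

Lemma enum_ord_subseq (n : nat) (s : seq 'I_n) :
  (forall j, j \in s) ->
  (forall j j' : 'I_n, (j <= j')%N -> (index j s <= index j' s)%N) ->
  subseq (enum 'I_n) s.
Proof.
move=> s_all s_mono; apply: subseq_index_sorted => [j _|]; first exact: s_all.
have: sorted ltn (map val (enum 'I_n)) by rewrite val_enum_ord iota_ltn_sorted.
rewrite sorted_map; apply: sub_sorted => j j' /= lt_jj'.
rewrite ltn_neqAle s_mono ?andbT; last exact: ltnW.
apply: contraTN lt_jj' => /eqP eq_index.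
by rewrite (index_inj j (s_all j) (s_all j') eq_index) ltnn.
Qed.

(** * Two real inequalities *)

(** Cauchy-Schwarz for the pairs (1, sqrt m) and (a, sqrt b): it absorbs one
    further displacement a into a bound already obtained from m of them, so that
    only the number of displacements and the sum of their squares are carried
    through an induction. *)
Lemma addr_sqrt_le (R : realType) (a b m : R) : 0 <= a -> 0 <= b -> 0 <= m ->
  a + Num.sqrt (m * b) <= Num.sqrt ((m + 1) * (a ^+ 2 + b)).
Proof.
move=> a0 b0 m0; set q := Num.sqrt _.
have q0 : 0 <= q by exact: sqrtr_ge0.
have q2 : q ^+ 2 = m * b by rewrite sqr_sqrtr// mulr_ge0.
rewrite -(ger0_norm (addr_ge0 a0 q0)) -sqrtr_sqr ler_wsqrtr// sqrrD q2.
pose p := Num.sqrt m; pose r := Num.sqrt b.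
have pE : p ^+ 2 = m by rewrite sqr_sqrtr.
have rE : r ^+ 2 = b by rewrite sqr_sqrtr.
have qE : q = p * r by rewrite /q sqrtrM.
(* The difference of the two sides is the square of p a - r. *)
rewrite qE -pE -rE; have := sqr_ge0 (p * a - r); nra.
Qed.

(** With e = a - b, the hypothesis says d a <= e + q where
    q ^+ 2 = m (a - b) (a + b) <= 2 m a e, and e ^+ 2 <= a e since e <= a.  Hence
    (d a) ^+ 2 <= 2 e ^+ 2 + 2 q ^+ 2 <= (2 + 4 m) a e <= 8 (m + 1) a e. *)
Lemma defect_bound (R : realType) (d m a b : R) :
  0 <= d -> 0 <= m -> 0 <= b <= a ->
  b <= (1 - d) * a + Num.sqrt (m * (a ^+ 2 - b ^+ 2)) ->
  b <= (1 - d ^+ 2 / (8 * (m + 1))) * a.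
Proof.
move=> d0 m0 /andP[b0 ba]; set q : R := Num.sqrt _ => bq.
have q0 : 0 <= q by exact: sqrtr_ge0.
have q2 : q ^+ 2 = m * (a ^+ 2 - b ^+ 2).
  by rewrite sqr_sqrtr// mulr_ge0// subr_ge0 ler_pXn2r ?nnegrE//; lra.
have [a_le0|a_gt0] := leP a 0.
  by rewrite (_ : a = 0) ?mulr0; lra.
clearbody q; pose e := a - b.
have e0 : 0 <= e by rewrite subr_ge0.
have q2e : q ^+ 2 <= 2 * (m * (a * e)).
  by rewrite q2 /e; have := mulr_ge0 m0 (sqr_ge0 (a - b)); nra.
have da_le : d * a <= e + q by rewrite /e; lra.
have e2 : e ^+ 2 <= a * e by rewrite expr2 ler_wpM2r// /e; lra.
have key : (d * a) ^+ 2 <= 8 * (m + 1) * (a * e).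
  apply: (@le_trans _ _ ((e + q) ^+ 2)).
    have da0 : 0 <= d * a by rewrite mulr_ge0// ltW.
    by rewrite ler_pXn2r// nnegrE (le_trans da0).
  have mae : 0 <= m * (a * e) by rewrite !mulr_ge0// ltW.
  have ae : 0 <= a * e by rewrite mulr_ge0// ltW.
  by have := sqr_ge0 (e - q); nra.
have {}key : d ^+ 2 * a <= e * (8 * (m + 1)).
  by rewrite -(ler_pM2r a_gt0); lra.
have m1 : 0 < 8 * (m + 1) by lra.
move: key; rewrite -ler_pdivrMr// /e mulrBl mul1r mulrAC; lra.
Qed.

(** * Norms with real values *)

Section RealNorm.
Variables (R : realType) (F : scalar_kind).

Lemma scalar_re0 : scalar_re (0 : scalars R F) = 0.
Proof. by case: F. Qed.

Lemma scalar_reD (a b : scalars R F) :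
  scalar_re (a + b) = scalar_re a + scalar_re b.
Proof. by case: F a b => [//|[? ?] [? ?]]. Qed.

Lemma scalar_re_le (a b : scalars R F) :
  a <= b -> scalar_re a <= scalar_re b.
Proof. by case: F a b => [//|[? ?] [? ?]]; rewrite lecE => /andP[]. Qed.

Lemma scalar_reM (a b : scalars R F) :
  0 <= a -> scalar_re (a * b) = scalar_re a * scalar_re b.
Proof.
case: F a b => [//|[? ?] [? ?]]; rewrite lecE => /andP[/= /eqP -> _].
by rewrite mul0r subr0.
Qed.

Lemma scalar_re_eq0 (a : scalars R F) :
  0 <= a -> (scalar_re a == 0) = (a == 0).
Proof.
case: F a => [//|[? ?]]; rewrite lecE => /andP[/= /eqP -> _].
by rewrite eq_complex/= eqxx andbT.
Qed.

Variable H : completeNormedModType (scalars R F).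

(** The norm of H takes its values in the scalar field, which is only partially
    ordered when it is complex; real values make real square roots and suprema
    applicable. *)
Definition rnorm (f : H) : R := scalar_re `|f|.

Lemma rnorm_ge0 f : 0 <= rnorm f.
Proof. by rewrite -scalar_re0; apply: scalar_re_le; exact: normr_ge0. Qed.

Lemma rnorm0 : rnorm 0 = 0.
Proof. by rewrite /rnorm normr0 scalar_re0. Qed.

Lemma rnorm_eq0 f : (rnorm f == 0) = (f == 0).
Proof. by rewrite /rnorm scalar_re_eq0 ?normr_ge0// normr_eq0. Qed.

Lemma rnormD f g : rnorm (f + g) <= rnorm f + rnorm g.
Proof. by rewrite -scalar_reD; apply: scalar_re_le; exact: ler_normD. Qed.

Lemma rnorm_sqr f : rnorm f ^+ 2 = scalar_re (`|f| ^+ 2).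
Proof. by rewrite expr2 scalar_reM// normr_ge0. Qed.

Lemma rnorm_ratio (f g : H) : g != 0 ->
  scalar_re (`|f| / `|g|) = rnorm f / rnorm g.
Proof.
move=> g0; have rg0 : rnorm g != 0 by rewrite rnorm_eq0.
apply: (mulIf rg0); rewrite mulfVK// mulrC -scalar_reM ?normr_ge0//.
by rewrite mulrC mulfVK// normr_eq0.
Qed.

Lemma opnorm_ge0 (A : H -> H) : 0 <= opnorm A.
Proof.
rewrite /opnorm; set E := (X in sup X).
have [[[x Ex] ubE]|/sup_out ->//] := pselect (has_sup E).
apply: le_trans (ub_le_sup ubE Ex).
by case: Ex => f /= f0 <-; rewrite rnorm_ratio// divr_ge0 ?rnorm_ge0.
Qed.

(** The sign condition on c covers the zero space, whose operators have norm the
    supremum of the empty set, that is 0. *)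
Lemma opnorm_le (A : H -> H) (c : R) : 0 <= c ->
  (forall f, rnorm (A f) <= c * rnorm f) -> opnorm A <= c.
Proof.
move=> c0 Ac; rewrite /opnorm; set E := (X in sup X).
have [->|E0] := eqVneq E set0; first by rewrite sup0.
apply: ge_sup; first exact/set0P.
move=> _ [f /= f0 <-]; rewrite rnorm_ratio// ler_pdivrMr ?Ac//.
by rewrite lt_def rnorm_eq0 f0 rnorm_ge0.
Qed.

(** The constant c only certifies that A is bounded, which makes the supremum
    defining its norm an upper bound. *)
Lemma rnorm_le_opnorm (A : H -> H) (c : R) :
  A 0 = 0 -> (forall f, rnorm (A f) <= c * rnorm f) ->
  forall f, rnorm (A f) <= opnorm A * rnorm f.
Proof.
move=> A0 Ac f; have [->|f0] := eqVneq f 0; first by rewrite A0 rnorm0 mulr0.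
have rnorm_gt0 g : g != 0 -> 0 < rnorm g.
  by move=> g0; rewrite lt_def rnorm_eq0 g0 rnorm_ge0.
rewrite -ler_pdivrMr ?rnorm_gt0// -rnorm_ratio//; apply: ub_le_sup.
  exists c => _ [g /= g0 <-].
  by rewrite rnorm_ratio// ler_pdivrMr ?rnorm_gt0 ?Ac.
by exists f.
Qed.

(** * Products of orthogonal projections *)

Variable ip : {dot H for @scalar_conj R F}.
Hypothesis ip_norm : norm_induced_by ip.

(** Pythagoras: f - Q f lies in the kernel of Q, hence is orthogonal to Q f. *)
Lemma rnorm_projection (Q : {linear H -> H}) (f : H) :
  orthogonal_projection ip Q ->
  rnorm f ^+ 2 = rnorm (Q f) ^+ 2 + rnorm (f - Q f) ^+ 2.
Proof.
case=> _ QQ Qsym; rewrite !rnorm_sqr -scalar_reD !ip_norm; congr scalar_re.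
have Qker : Q (f - Q f) = 0 by rewrite linearB/= QQ subrr.
have ip10 : ip (Q f) (f - Q f) = 0 by rewrite Qsym Qker linear0r.
have ip01 : ip (f - Q f) (Q f) = 0 by rewrite -Qsym Qker linear0l.
have fE : f = Q f + (f - Q f) by rewrite addrC subrK.
move: (f - Q f) fE ip10 ip01 => g fE ip10 ip01.
by rewrite [in LHS]fE linearDl !linearDr /= ip10 ip01 addr0 add0r.
Qed.

Lemma rnorm_projection_le (Q : {linear H -> H}) (f : H) :
  orthogonal_projection ip Q -> rnorm (Q f) <= rnorm f.
Proof.
move=> Qproj; rewrite -(@ler_pXn2r _ 2)// ?nnegrE ?rnorm_ge0//.
by rewrite (rnorm_projection f Qproj) lerDl sqr_ge0.
Qed.

Variables (n : nat) (P : 'I_n -> {linear H -> H}).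
Hypothesis P_proj : forall j, orthogonal_projection ip (P j).

Lemma opprod_cons (j : 'I_n) s f : opprod P (j :: s) f = opprod P s (P j f).
Proof.
rewrite /opprod /=.
have foldl_out : forall A g, foldl (fun (A : H -> H) j => P j \o A) A s g
    = foldl (fun (A : H -> H) j => P j \o A) idfun s (A g).
  by elim: s => //= k s IH A g; rewrite IH [in RHS]IH.
by rewrite foldl_out.
Qed.

Lemma opprod0 s : opprod P s 0 = 0.
Proof. by elim: s => // j s IH; rewrite opprod_cons linear0. Qed.

Lemma rnorm_opprod_le s f : rnorm (opprod P s f) <= rnorm f.
Proof.
elim: s f => // j s IH f; rewrite opprod_cons (le_trans (IH _))//.
exact: rnorm_projection_le.
Qed.

(** Two different starting vectors f and g are needed because, after a factor
    that only s applies, the two products continue from different vectors.  The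
    size difference counts the omitted factors; only their displacements enter
    the sum, and its square is bounded by their number times the total loss of
    squared norm along s. *)
Lemma opprod_subseq_close t s f g : subseq t s ->
  rnorm (opprod P s f - opprod P t g) <= rnorm (f - g)
    + Num.sqrt ((size s - size t)%N%:R
                 * (rnorm f ^+ 2 - rnorm (opprod P s f) ^+ 2)).
Proof.
elim: s t f g => [|j s IH] t f g.
  by rewrite subseq0 => /eqP -> /=; rewrite lerDl sqrtr_ge0.
have drop0 h r : 0 <= rnorm h ^+ 2 - rnorm (opprod P r h) ^+ 2.
  by rewrite subr_ge0 ler_pXn2r ?nnegrE ?rnorm_ge0 ?rnorm_opprod_le.
(* The step where only the longer product applies P j. *)
have skip u : subseq u s ->
    rnorm (opprod P (j :: s) f - opprod P u g) <= rnorm (f - g)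
    + Num.sqrt ((size (j :: s) - size u)%N%:R
                 * (rnorm f ^+ 2 - rnorm (opprod P (j :: s) f) ^+ 2)).
  move=> us; rewrite opprod_cons (le_trans (IH _ _ _ us))//.
  rewrite (rnorm_projection f (P_proj j)) [size _]/= subSn ?size_subseq//.
  have {}drop0 := drop0 (P j f) s.
  have := addr_sqrt_le (rnorm_ge0 (f - P j f)) drop0 (ler0n _ (size s - size u)).
  rewrite natr1 addrA [_ ^+ 2 + rnorm (P j f) ^+ 2]addrC => sqrt_step.
  have := rnormD (P j f - f) (f - g).
  rewrite subrKA [rnorm (P j f - f)]/rnorm distrC -/(rnorm _).
  lra.
case: t => [|k t] st; first exact: skip (sub0seq _).
move: st; rewrite /=; case: eqP => [->|_] st; last exact: skip.
rewrite !opprod_cons subSS (le_trans (IH _ _ _ st))// -linearB.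
apply: lerD; first exact: rnorm_projection_le.
rewrite ler_wsqrtr// ler_wpM2l// lerB// ler_pXn2r ?nnegrE ?rnorm_ge0//.
exact: rnorm_projection_le.
Qed.

End RealNorm.

Theorem theorem1p4 (R : realType) (F : scalar_kind)
    (H : completeNormedModType (scalars R F))
    (ip : {dot H for @scalar_conj R F}) (ip_norm : norm_induced_by ip)
    (n : nat) (n_ge1 : (1 <= n)%N)
    (delta : R) (delta_ge0 : 0 <= delta)
    (P : 'I_n -> {linear H -> H})
    (P_proj : forall j, orthogonal_projection ip (P j))
    (P_norm : opnorm (opprod P (enum 'I_n)) <= 1 - delta)
    (L : nat) (i : L.-tuple 'I_n)
    (i_all : forall j : 'I_n, j \in i)
    (k_first : forall j : 'I_n, nat_of_ord j = 0%N -> first_pos i j = 1%N)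
    (k_mono : forall j j' : 'I_n, (j <= j')%N -> (first_pos i j <= first_pos i j')%N)
    (k_last : forall j : 'I_n, (nat_of_ord j).+1 = n -> first_pos i j = L) :
  opnorm (opprod P i) <= 1 - delta ^+ 2 / (8 * (L%:R - n%:R + 1)).
Proof.
have sub_i : subseq (enum 'I_n) i by apply: enum_ord_subseq.
have le_nL : (n <= L)%N.
  by have := size_subseq sub_i; rewrite size_enum_ord size_tuple.
rewrite -natrB//; set m := (L - n)%N%:R.
have m0 : 0 <= m :> R by exact: ler0n.
have delta_le1 : delta <= 1.
  by have := opnorm_ge0 (opprod P (enum 'I_n)); lra.
apply: opnorm_le => [|f].
  rewrite subr_ge0 ler_pdivrMr ?mul1r; last lra.
  by have := ler_piMl delta_ge0 delta_le1; rewrite expr2; lra.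
apply: defect_bound => //; first by rewrite rnorm_ge0 (rnorm_opprod_le ip_norm).
have := opprod_subseq_close ip_norm P_proj f f sub_i.
rewrite subrr rnorm0 add0r size_enum_ord size_tuple -/m => close.
have enum_le : rnorm (opprod P (enum 'I_n) f) <= (1 - delta) * rnorm f.
  apply: le_trans (ler_wpM2r (rnorm_ge0 f) P_norm).
  apply: (@rnorm_le_opnorm _ _ _ _ 1); first exact: opprod0.
  by move=> g; rewrite mul1r (rnorm_opprod_le ip_norm).
have := rnormD (opprod P (enum 'I_n) f) (opprod P i f - opprod P (enum 'I_n) f).
rewrite addrC subrK; lra.
Qed.
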